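(* Let $0<a<1$. Suppose that $g\in H^2(\mathbb{D})$ is such that $g'$ is $\mathbf{EB}$ and there exists a subsequence of $(g(1-a^n))_{n\in\mathbb{N}}$ which is bounded away from zero. Then the constant function $1$ belongs to $K_g$. Consequently, $K_g$ is a minimal invariant subspace of $C_{\phi_a}$ if and only if $\dim K_g=1$.
   Context: $H^2=H^2(\mathbb{D})$ is the Hardy-Hilbert space of holomorphic functions on the open unit disk $\mathbb{D}$. For $a\in(0,1)$, $\phi_a(z)=az+1-a$, a holomorphic self-map of $\mathbb{D}$, and $C_{\phi_a}f=f\circ\phi_a$ is the (bounded) composition operator on $H^2$. For $f\in H^2$, $K_f:=\overline{\mathrm{span}\{f,C_{\phi_a}f,C_{\phi_a}^2f,\ldots\}}$ (closure in $H^2$). A minimal invariant subspace of $C_{\phi_a}$ is a nonzero closed invariant subspace whose only closed $C_{\phi_a}$-invariant subspaces are $\{0\}$ and itself. For $n\in\mathbb{N}$ let $D_n:=\phi_{a^n}(\mathbb{D})=a^n\mathbb{D}+1-a^n$, the disk with center $1-a^n$ and radius $a^n$. A holomorphic function on $\mathbb{D}$ is called eventually bounded at $1$ ($\mathbf{EB}$) if it is bounded on $D_n$ for some $n\in\mathbb{N}$. A subsequence $(g(1-a^{n_k}))_k$ is bounded away from zero if there is $M>0$ with $|g(1-a^{n_k})|\ge M$ for all $k$. *)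

(* Defs.v *)
From Stdlib Require Import Reals Lra.
From Coquelicot Require Import Coquelicot.
Open Scope R_scope.

Definition disk : Type := {z : C | Cmod z < 1}.

Definition fn : Type := disk -> C.

Definition fn_zero : fn := fun _ => RtoC 0.
Definition fn_one : fn := fun _ => RtoC 1.
Definition fn_add (f g : fn) : fn := fun z => Cplus (f z) (g z).
Definition fn_sub (f g : fn) : fn := fun z => Cminus (f z) (g z).
Definition fn_scal (c : C) (f : fn) : fn := fun z => Cmult c (f z).

(* Extension by zero to the whole plane. It is only ever evaluated, and only
   ever differentiated, at points of the open disk, so the value chosen outside
   is immaterial. *)
Definition ext0 (f : fn) (z : C) : C :=
  match Rlt_dec (Cmod z) 1 with
  | left h => f (exist _ z h)
  | right _ => RtoC 0
  end.

Definition holomorphic (f : fn) : Prop :=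
  forall z : disk, ex_derive (K := C_AbsRing) (ext0 f) (proj1_sig z).

Definition deriv (f : fn) : fn := fun z => C_derive (ext0 f) (proj1_sig z).

(* ((1 / 2pi) int_0^{2pi} |f(r e^{it})|^2 dt)^{1/2} *)
Definition integral_mean (f : fn) (r : R) : R :=
  sqrt (RInt (fun t => Cmod (ext0 f (r * cos t, r * sin t)) ^ 2) 0 (2 * PI)
        / (2 * PI)).

(* The supremum is taken in the extended reals, so that functions outside H^2
   have norm p_infty. *)
Definition hardy_norm (f : fn) : Rbar :=
  Lub_Rbar (fun x => exists r, 0 < r < 1 /\ x = integral_mean f r).

Definition H2 (f : fn) : Prop :=
  holomorphic f /\ Rbar_lt (hardy_norm f) p_infty.

Fixpoint lincomb (n : nat) (c : nat -> C) (e : nat -> fn) : fn :=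
  match n with
  | O => fn_zero
  | S m => fn_add (lincomb m c e) (fn_scal (c m) (e m))
  end.

Definition span (e : nat -> fn) (f : fn) : Prop :=
  exists n c, f = lincomb n c e.

Definition H2_closure (S : fn -> Prop) (f : fn) : Prop :=
  H2 f /\
  forall eps : R, 0 < eps ->
    exists p, S p /\ Rbar_lt (hardy_norm (fn_sub f p)) eps.

Definition closed_subspace (M : fn -> Prop) : Prop :=
  (forall f, M f -> H2 f) /\
  M fn_zero /\
  (forall f g, M f -> M g -> M (fn_add f g)) /\
  (forall c f, M f -> M (fn_scal c f)) /\
  (forall f, H2_closure M f -> M f).

(* e 0, ..., e (n - 1) is a basis of M. *)
Definition has_dim (M : fn -> Prop) (n : nat) : Prop :=
  exists e : nat -> fn,
    (forall i, (i < n)%nat -> M (e i)) /\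
    (forall c, lincomb n c e = fn_zero ->
       forall i, (i < n)%nat -> c i = RtoC 0) /\
    (forall f, M f -> exists c, f = lincomb n c e).

Definition phi (a : R) (z : C) : C := (RtoC a * z + RtoC 1 - RtoC a)%C.

Lemma phi_disk (a : R) (ha : 0 < a < 1) (z : C) :
  Cmod z < 1 -> Cmod (phi a z) < 1.
Proof.
intros hz.
replace (phi a z) with (RtoC a * z + RtoC (1 - a))%C
  by (unfold phi; rewrite RtoC_minus; ring).
eapply Rle_lt_trans; [apply Cmod_triangle|].
rewrite Cmod_mult, !Cmod_R, !Rabs_pos_eq by lra.
nra.
Qed.

(* By phi_disk, for 0 < a < 1 this is z |-> f (phi a z). *)
Definition comp_op (a : R) (f : fn) : fn :=
  fun z => ext0 f (phi a (proj1_sig z)).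

Definition cyclic_subspace (a : R) (f : fn) : fn -> Prop :=
  H2_closure (span (fun n => Nat.iter n (comp_op a) f)).

Definition invariant (a : R) (M : fn -> Prop) : Prop :=
  forall f, M f -> M (comp_op a f).

Definition minimal_invariant (a : R) (M : fn -> Prop) : Prop :=
  closed_subspace M /\ invariant a M /\
  (exists f, M f /\ f <> fn_zero) /\
  forall N : fn -> Prop,
    closed_subspace N -> invariant a N -> (forall f, N f -> M f) ->
    (forall f, N f <-> f = fn_zero) \/ (forall f, N f <-> M f).

Definition disk_n (a : R) (n : nat) (z : C) : Prop :=
  exists w : disk, z = phi (a ^ n) (proj1_sig w).

Definition eventually_bounded (a : R) (f : fn) : Prop :=
  exists (n : nat) (B : R),
    forall z : disk, disk_n a n (proj1_sig z) -> Cmod (f z) <= B.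

Definition has_subseq_away_from_zero (u : nat -> C) : Prop :=
  exists s : nat -> nat,
    (forall k, (s k < s (S k))%nat) /\
    exists M : R, 0 < M /\ forall k, M <= Cmod (u (s k)).

(* Main.v *)
Require Import Defs.
From Stdlib Require Import Reals Lra Lia.
From Stdlib Require Import FunctionalExtensionality PropExtensionality Classical.
From Coquelicot Require Import Coquelicot.
Open Scope R_scope.

(** On D_n, the disk with centre 1 - a^n and radius a^n, the boundedness of g'
    makes g nearly constant: by the mean value inequality, g differs from
    g(1 - a^n) by O(a^n) ([iterates_near_constant]). But g on D_n is the n-th
    iterate of the composition operator applied to g. Hence, along the
    subsequence on which g(1 - a^n) stays away from zero, the normalised iterates
    converge to 1 uniformly on the disk. The sup norm dominates the Hardy norm,
    so every constant lies in K_g ([constants_in_cyclic_subspace]).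

    For the equivalence, the constants form a closed invariant line. Closedness is
    the one point with content: if constants approximate f in Hardy norm, then
    they approximate f at every point, because a deviation at one point persists
    on an arc of a circle ([hardy_norm_small_at_point]), and therefore all values
    of f coincide ([limit_of_constants_constant]). Since K_g contains the
    constants, it is minimal exactly when it equals them, and one-dimensional
    exactly when it equals them ([minimal_iff_dim_1]). *)

(** * Moduli, and functions on the disk *)

Lemma Cmod_le_parts (z : C) : Cmod z <= Rabs (fst z) + Rabs (snd z).
Proof.
replace z with (RtoC (fst z) + Ci * RtoC (snd z))%C at 1.
- eapply Rle_trans; [apply Cmod_triangle|].
  rewrite Cmod_mult, !Cmod_R.
  replace (Cmod Ci) with 1; [lra|].
  unfold Cmod, Ci; simpl; replace (0 * (0 * 1) + 1 * (1 * 1)) with 1 by ring.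
  now rewrite sqrt_1.
- destruct z as [x y]; unfold Cplus, Cmult, RtoC, Ci; simpl; f_equal; ring.
Qed.

Lemma Cmod_minus_sym (z w : C) : Cmod (z - w) = Cmod (w - z).
Proof. rewrite <- Cmod_opp; f_equal; ring. Qed.

Lemma Rabs_Cmod_minus (z w : C) : Rabs (Cmod z - Cmod w) <= Cmod (z - w).
Proof.
pose proof (Cmod_triangle (z - w) w) as h1.
pose proof (Cmod_triangle (w - z) z) as h2.
replace (z - w + w)%C with z in h1 by ring.
replace (w - z + z)%C with w in h2 by ring.
rewrite (Cmod_minus_sym w z) in h2.
apply Rabs_le; lra.
Qed.

Lemma ext0_in (f : fn) (z : C) (h : Cmod z < 1) : ext0 f z = f (exist _ z h).
Proof.
unfold ext0; destruct (Rlt_dec (Cmod z) 1) as [h'|]; [|contradiction].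
now rewrite (proof_irrelevance _ h h').
Qed.

(** The regularity needed of every function whose integral means are estimated:
    without integrability over circles [RInt], hence the Hardy norm, carries no
    information. Unlike [holomorphic] it passes trivially to differences,
    multiples and composites with [phi]. *)
Definition disk_continuous (f : fn) : Prop :=
  forall z : C, Cmod z < 1 -> forall eps : R, 0 < eps ->
  exists d, 0 < d /\ forall w, Cmod w < 1 -> Cmod (w - z) < d ->
    Cmod (ext0 f w - ext0 f z) < eps.

Lemma is_derive_C_eps (F : C -> C) (z l : C) :
  is_derive (K := C_AbsRing) F z l -> forall eps : R, 0 < eps ->
  exists d, 0 < d /\ forall w, Cmod (w - z) < d ->
    Cmod (F w - F z - (w - z) * l) <= eps * Cmod (w - z).
Proof.
intros [_ H] eps heps.
destruct (H z (fun P hP => hP) (mkposreal eps heps)) as [d hd].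
exists (pos d); split; [apply cond_pos|].
intros w hw; exact (hd w hw).
Qed.

Lemma holomorphic_continuous (f : fn) : holomorphic f -> disk_continuous f.
Proof.
intros hf z hz eps heps.
destruct (hf (exist _ z hz)) as [l hl]; simpl in hl.
destruct (is_derive_C_eps _ _ _ hl 1 Rlt_0_1) as [d [hd H]].
set (K := 1 + Cmod l).
assert (hK : 0 < K) by (unfold K; pose proof (Cmod_ge_0 l); lra).
exists (Rmin d (eps / K)); split.
- apply Rmin_glb_lt; [lra|]. now apply Rdiv_lt_0_compat.
- intros w _ hw.
  assert (h1 := Rlt_le_trans _ _ _ hw (Rmin_l _ _)).
  assert (h2 := Rlt_le_trans _ _ _ hw (Rmin_r _ _)).
  specialize (H w h1).
  replace (ext0 f w - ext0 f z)%C
    with ((ext0 f w - ext0 f z - (w - z) * l) + (w - z) * l)%C by ring.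
  eapply Rle_lt_trans; [apply Cmod_triangle|].
  rewrite Cmod_mult.
  apply Rle_lt_trans with (K * Cmod (w - z)); [unfold K; lra|].
  apply Rlt_le_trans with (K * (eps / K)).
  + now apply Rmult_lt_compat_l.
  + right; field; lra.
Qed.

Lemma disk_continuous_one : disk_continuous fn_one.
Proof.
intros z hz eps heps; exists 1; split; [lra|]; intros w hw _.
rewrite (ext0_in _ _ hw), (ext0_in _ _ hz); unfold fn_one.
replace (RtoC 1 - RtoC 1)%C with (RtoC 0) by ring.
now rewrite Cmod_0.
Qed.

Lemma disk_continuous_scal (k : C) (f : fn) :
  disk_continuous f -> disk_continuous (fn_scal k f).
Proof.
intros hf z hz eps heps.
set (K := 1 + Cmod k).
assert (hK : 0 < K) by (unfold K; pose proof (Cmod_ge_0 k); lra).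
destruct (hf z hz (eps / K)) as [d [hd H]]; [now apply Rdiv_lt_0_compat|].
exists d; split; [assumption|]; intros w hw hwz.
specialize (H w hw hwz).
rewrite (ext0_in f w hw), (ext0_in f z hz) in H.
rewrite (ext0_in _ w hw), (ext0_in _ z hz); unfold fn_scal.
set (p := f (exist _ w hw)) in *; set (q := f (exist _ z hz)) in *.
replace (k * p - k * q)%C with (k * (p - q))%C by ring.
rewrite Cmod_mult.
apply Rle_lt_trans with (K * Cmod (p - q)).
- apply Rmult_le_compat_r; [apply Cmod_ge_0|unfold K; lra].
- apply Rlt_le_trans with (K * (eps / K)); [now apply Rmult_lt_compat_l|].
  right; field; lra.
Qed.

Lemma disk_continuous_sub (f g : fn) :
  disk_continuous f -> disk_continuous g -> disk_continuous (fn_sub f g).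
Proof.
intros hf hg z hz eps heps.
destruct (hf z hz (eps / 2)) as [d [hd H]]; [lra|].
destruct (hg z hz (eps / 2)) as [d' [hd' H']]; [lra|].
exists (Rmin d d'); split; [now apply Rmin_glb_lt|]; intros w hw hwz.
specialize (H w hw (Rlt_le_trans _ _ _ hwz (Rmin_l _ _))).
specialize (H' w hw (Rlt_le_trans _ _ _ hwz (Rmin_r _ _))).
rewrite (ext0_in f w hw), (ext0_in f z hz) in H.
rewrite (ext0_in g w hw), (ext0_in g z hz) in H'.
rewrite (ext0_in _ w hw), (ext0_in _ z hz); unfold fn_sub.
set (p := f (exist _ w hw)) in *; set (q := f (exist _ z hz)) in *.
set (p' := g (exist _ w hw)) in *; set (q' := g (exist _ z hz)) in *.
replace (p - p' - (q - q'))%C with ((p - q) + - (p' - q'))%C by ring.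
eapply Rle_lt_trans; [apply Cmod_triangle|]; rewrite Cmod_opp; lra.
Qed.

Lemma disk_continuous_comp_op (a : R) (ha : 0 < a < 1) (f : fn) :
  disk_continuous f -> disk_continuous (comp_op a f).
Proof.
intros hf z hz eps heps.
destruct (hf _ (phi_disk a ha z hz) eps heps) as [d [hd H]].
exists d; split; [assumption|]; intros w hw hwz.
rewrite (ext0_in _ _ hw), (ext0_in _ _ hz); unfold comp_op; simpl.
apply H; [now apply phi_disk|].
replace (phi a w - phi a z)%C with (RtoC a * (w - z))%C by (unfold phi; ring).
rewrite Cmod_mult, Cmod_R, Rabs_pos_eq by lra.
pose proof (Cmod_ge_0 (w - z)); nra.
Qed.

(** * The mean value inequality *)

(** Restricting to a real segment and taking the real part of a fixed multiple
    turns a complex derivative into a real one, to which the real mean value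
    theorem applies. *)
Lemma is_derive_real_path (F : C -> C) (k z v l : C) (t : R) :
  is_derive (K := C_AbsRing) F (z + RtoC t * v)%C l ->
  is_derive (fun s : R => Re (k * F (z + RtoC s * v))%C) t (Re (k * (l * v))%C).
Proof.
intros H.
split; [apply is_linear_scal_l|].
intros x hx.
rewrite <- (is_filter_lim_locally_unique _ _ hx); clear x hx.
intros [eps heps].
(* the added 1 keeps both divisors positive when k or v vanishes *)
set (A := 1 + Cmod k * Cmod v). set (B := 1 + Cmod v).
assert (hA : 0 < A).
{ unfold A; pose proof (Cmod_ge_0 k); pose proof (Cmod_ge_0 v).
  pose proof (Rmult_le_pos _ _ H0 H1); lra. }
assert (hB : 0 < B) by (unfold B; pose proof (Cmod_ge_0 v); lra).
destruct (is_derive_C_eps _ _ _ H (eps / A)) as [d [hd D]];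
  [now apply Rdiv_lt_0_compat|].
exists (mkposreal (d / B) (Rdiv_lt_0_compat _ _ hd hB)).
intros s hs.
change (Rabs (s - t) < d / B) in hs.
change (Rabs (Re (k * F (z + RtoC s * v)%C)%C - Re (k * F (z + RtoC t * v)%C)%C
   - (s - t) * Re (k * (l * v))%C) <= eps * Rabs (s - t)).
assert (E : ((z + RtoC s * v) - (z + RtoC t * v))%C = (RtoC (s - t) * v)%C)
  by (rewrite RtoC_minus; ring).
specialize (D (z + RtoC s * v)%C).
rewrite E, Cmod_mult, Cmod_R in D.
replace (Re (k * F (z + RtoC s * v)%C)%C - Re (k * F (z + RtoC t * v)%C)%C
   - (s - t) * Re (k * (l * v))%C)
 with (Re (k * (F (z + RtoC s * v) - F (z + RtoC t * v) - RtoC (s - t) * v * l))%C).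
2: { generalize (F (z + RtoC s * v)%C) (F (z + RtoC t * v)%C).
  intros [x1 y1] [x2 y2]; destruct k, l, v; unfold Re, Cminus, Cplus, Copp, Cmult, RtoC; simpl; ring. }
eapply Rle_trans; [apply re_le_Cmod|].
rewrite Cmod_mult.
pose proof (Cmod_ge_0 k) as hk. pose proof (Cmod_ge_0 v) as hv.
pose proof (Rabs_pos (s - t)) as hst.
apply Rle_trans with (Cmod k * (eps / A * (Rabs (s - t) * Cmod v))).
- apply Rmult_le_compat_l; [assumption|apply D].
  apply Rle_lt_trans with (Rabs (s - t) * B); [unfold B; nra|].
  apply Rlt_le_trans with (d / B * B); [now apply Rmult_lt_compat_r|].
  right; field; lra.
- replace (Cmod k * (eps / A * (Rabs (s - t) * Cmod v)))
    with (eps / A * (Cmod k * Cmod v) * Rabs (s - t)) by ring.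
  apply Rmult_le_compat_r; [assumption|].
  apply Rle_trans with (eps / A * A); [|right; field; lra].
  apply Rmult_le_compat_l; [|unfold A; lra].
  now apply Rlt_le, Rdiv_lt_0_compat.
Qed.

(** A complex function has no mean value theorem, but one rotation suffices: if
    D is the increment, then t |-> Re (conj D * f (z + t v)) increases by exactly
    |D|^2 on [0, 1], while its derivative is at most |D| * B * |v|. The bound is
    requested for |t| <= 1, on the segment reflected through z as well, because
    [bounded_variation] works on symmetric intervals. *)
Lemma mean_value_inequality (f : fn) (hf : holomorphic f) (z v : C) (B : R)
  (hB : forall t : R, Rabs t <= 1 ->
     exists h : Cmod (z + RtoC t * v) < 1, Cmod (deriv f (exist _ _ h)) <= B) :
  Cmod (ext0 f (z + v) - ext0 f z) <= B * Cmod v.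
Proof.
set (D := (ext0 f (z + v) - ext0 f z)%C).
assert (H := bounded_variation (fun s : R => Re (Cconj D * ext0 f (z + RtoC s * v))%C)
  (fun s : R => Re (Cconj D * (C_derive (ext0 f) (z + RtoC s * v) * v))%C)
  (Cmod D * (B * Cmod v)) 0 1).
cbv beta in H.
replace (z + RtoC 1 * v)%C with (z + v)%C in H by ring.
replace (z + RtoC 0 * v)%C with z in H by ring.
replace (Re (Cconj D * ext0 f (z + v))%C - Re (Cconj D * ext0 f z)%C)
  with (Cmod D * Cmod D) in H.
2: { transitivity (Re (Cconj D * D)%C).
  - rewrite Cmult_comm, <- Cmod2_conj, re_RtoC. ring.
  - unfold D; generalize (ext0 f (z + v)%C) (ext0 f z).
    intros [x1 y1] [x2 y2]; unfold Re, Cconj, Cminus, Cplus, Copp, Cmult; simpl; ring. }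
rewrite Rminus_0_r, Rabs_R1, Rmult_1_r, Rabs_pos_eq in H
  by (apply Rmult_le_pos; apply Cmod_ge_0).
pose proof (Cmod_ge_0 D) as hD. pose proof (Cmod_ge_0 v) as hv.
assert (hB0 : 0 <= B).
{ destruct (hB 0) as [h hh]; [rewrite Rabs_R0; lra|].
  eapply Rle_trans; [apply Cmod_ge_0|exact hh]. }
destruct (Req_dec (Cmod D) 0) as [e|ne]; [rewrite e; now apply Rmult_le_pos|].
apply Rmult_le_reg_l with (Cmod D); [lra|].
apply H; intros t ht; rewrite Rminus_0_r in ht.
destruct (hB t ht) as [h hh].
split.
- apply is_derive_real_path, C_derive_correct; [exact z|].
  exact (hf (exist _ _ h)).
- eapply Rle_trans; [apply re_le_Cmod|].
  rewrite !Cmod_mult, Cmod_conj.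
  apply Rmult_le_compat_l; [assumption|].
  apply Rmult_le_compat_r; assumption.
Qed.

(** * Integral means over circles *)

Lemma Cmod_circle (r t : R) : 0 <= r -> Cmod (r * cos t, r * sin t) = r.
Proof.
intros hr; unfold Cmod; simpl.
replace (r * cos t * (r * cos t * 1) + r * sin t * (r * sin t * 1))
  with (r * r * ((sin t)² + (cos t)²)) by (unfold Rsqr; ring).
rewrite sin2_cos2, Rmult_1_r; now apply sqrt_square.
Qed.

Lemma circle_continuous (f : fn) (hf : disk_continuous f) (r t : R) (hr : 0 < r < 1)
  (eps : R) (heps : 0 < eps) :
  exists d, 0 < d /\ forall s, Rabs (s - t) < d ->
    Cmod (ext0 f (r * cos s, r * sin s) - ext0 f (r * cos t, r * sin t)) < eps.
Proof.
destruct (hf (r * cos t, r * sin t)) with (eps := eps) as [d [hd H]];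
  [rewrite Cmod_circle; lra|assumption|].
exists (d / 2); split; [lra|].
intros s hs; apply H; [rewrite Cmod_circle; lra|].
eapply Rle_lt_trans; [apply Cmod_le_parts|]; simpl.
assert (hc : Rabs (cos s - cos t) <= 1 * Rabs (s - t)).
{ apply bounded_variation with (dh := fun u => - sin u); intros u _; split.
  - apply is_derive_Reals, derivable_pt_lim_cos.
  - apply Rabs_le; pose proof (SIN_bound u); lra. }
assert (hsn : Rabs (sin s - sin t) <= 1 * Rabs (s - t)).
{ apply bounded_variation with (dh := cos); intros u _; split.
  - apply is_derive_Reals, derivable_pt_lim_sin.
  - apply Rabs_le; pose proof (COS_bound u); lra. }
replace (r * cos s + - (r * cos t)) with (r * (cos s - cos t)) by ring.
replace (r * sin s + - (r * sin t)) with (r * (sin s - sin t)) by ring.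
rewrite !Rabs_mult, (Rabs_pos_eq r) by lra.
pose proof (Rabs_pos (cos s - cos t)); pose proof (Rabs_pos (sin s - sin t)); nra.
Qed.

Lemma ex_RInt_circle (f : fn) (hf : disk_continuous f) (r u v : R) (hr : 0 < r < 1) :
  ex_RInt (fun t => Cmod (ext0 f (r * cos t, r * sin t)) ^ 2) u v.
Proof.
apply (@ex_RInt_continuous R_CompleteNormedModule); intros t _.
apply (continuous_comp (U := R_UniformSpace) (V := R_UniformSpace) (W := R_UniformSpace)
  (fun t => Cmod (ext0 f (r * cos t, r * sin t))) (fun x => x ^ 2)).
- apply (proj2 (filterlim_locally _ _)); intros eps.
  destruct (circle_continuous f hf r t hr eps (cond_pos eps)) as [d [hd H]].
  exists (mkposreal d hd); intros s hs.
  eapply Rle_lt_trans; [|exact (H s hs)].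
  apply Rabs_Cmod_minus.
- apply (ex_derive_continuous (fun x : R => x ^ 2)); auto_derive; exact I.
Qed.

(** The normalised measure on a circle has mass one, so the sup norm dominates
    the Hardy norm; all upper estimates of Hardy norms come from here. *)
Lemma hardy_norm_le_sup (f : fn) (hf : disk_continuous f) (B : R)
  (hB : forall z : disk, Cmod (f z) <= B) : Rbar_le (hardy_norm f) B.
Proof.
assert (hB0 : 0 <= B).
{ assert (h0 : Cmod 0 < 1) by (rewrite Cmod_0; lra).
  eapply Rle_trans; [apply Cmod_ge_0|exact (hB (exist _ _ h0))]. }
apply Lub_Rbar_correct; intros x [r [hr ->]]; simpl.
unfold integral_mean.
rewrite <- (sqrt_pow2 B) by assumption.
apply sqrt_le_1_alt.
pose proof PI_RGT_0.
apply Rmult_le_reg_r with (2 * PI); [lra|].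
unfold Rdiv; rewrite Rmult_assoc, Rinv_l, Rmult_1_r by lra.
replace (B ^ 2 * (2 * PI)) with (RInt (fun _ => B ^ 2) 0 (2 * PI)).
2: { rewrite RInt_const. unfold scal; simpl; unfold mult; simpl; ring. }
apply RInt_le; [lra|now apply ex_RInt_circle|apply ex_RInt_const|].
intros t _.
apply pow_incr; split; [apply Cmod_ge_0|].
assert (h : Cmod (r * cos t, r * sin t) < 1) by (rewrite Cmod_circle; lra).
now rewrite (ext0_in _ _ h).
Qed.

Lemma circle_point (z : C) (hz : z <> 0) :
  exists t, 0 <= t <= 2 * PI /\ z = (Cmod z * cos t, Cmod z * sin t).
Proof.
assert (hm : 0 < Cmod z) by now apply Cmod_gt_0.
assert (hre : Rabs (fst z) <= Cmod z) by apply re_le_Cmod.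
assert (hsq : Cmod z ^ 2 = fst z ^ 2 + snd z ^ 2).
{ unfold Cmod; rewrite pow2_sqrt; [reflexivity|nra]. }
destruct z as [x y]; simpl fst in *; simpl snd in *.
set (r := Cmod (x, y)) in *.
assert (hx : -1 <= x / r <= 1).
{ apply Rabs_le_between; unfold Rdiv; rewrite Rabs_mult, Rabs_inv, (Rabs_pos_eq r) by lra.
  apply Rmult_le_reg_r with r; [lra|].
  rewrite Rmult_assoc, Rinv_l by lra; lra. }
assert (hs : sin (acos (x / r)) = Rabs y / r).
{ rewrite sin_acos by assumption.
  apply sqrt_lem_1.
  - unfold Rsqr; nra.
  - apply Rmult_le_pos; [apply Rabs_pos|left; now apply Rinv_0_lt_compat].
  - replace (Rabs y / r * (Rabs y / r)) with (Rabs y ^ 2 / r ^ 2) by (field; lra).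
    rewrite RPow_abs, Rabs_pos_eq by (apply pow2_ge_0).
    replace (y ^ 2) with (r ^ 2 - x ^ 2) by lra.
    unfold Rsqr; field; lra. }
pose proof (acos_bound (x / r)). pose proof PI_RGT_0.
destruct (Rle_dec 0 y) as [hy|hy].
- exists (acos (x / r)); split; [lra|].
  rewrite cos_acos, hs, Rabs_pos_eq by assumption.
  f_equal; field; lra.
- exists (2 * PI - acos (x / r)); split; [lra|].
  replace (2 * PI - acos (x / r)) with (- acos (x / r) + 2 * INR 1 * PI) by (simpl; ring).
  rewrite cos_period, sin_period, cos_neg, sin_neg, cos_acos, hs, Rabs_left by lra.
  f_equal; field; lra.
Qed.

(** How a bound on the Hardy norm is used: it is a supremum over radii, so each
    circle inherits the bound. *)
Lemma integral_mean_lt (f : fn) (r eps : R) :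
  0 < r < 1 -> Rbar_lt (hardy_norm f) eps -> integral_mean f r < eps.
Proof.
intros hr h.
assert (H := Rbar_le_lt_trans (integral_mean f r) _ _
  (proj1 (Lub_Rbar_correct _) _ (ex_intro _ r (conj hr eq_refl))) h).
exact H.
Qed.

(** * The subspace of constant functions *)

Definition constant_fn (f : fn) : Prop := exists c : C, f = fn_scal c fn_one.

Lemma disk_continuous_constant (f : fn) : constant_fn f -> disk_continuous f.
Proof. intros [c ->]; apply disk_continuous_scal, disk_continuous_one. Qed.

Lemma constant_H2 (f : fn) : constant_fn f -> H2 f.
Proof.
intros hf; split.
- destruct hf as [c ->]; intros [z hz]; simpl.
  apply ex_derive_ext_loc with (f := fun _ : C => c); [|apply ex_derive_const].
  assert (h : 0 < 1 - Cmod z) by lra.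
  exists (mkposreal _ h); intros w hw.
  change (Cmod (w - z) < 1 - Cmod z) in hw.
  assert (hw1 : Cmod w < 1).
  { replace w with ((w - z) + z)%C by ring.
    eapply Rle_lt_trans; [apply Cmod_triangle|]; lra. }
  rewrite (ext0_in _ _ hw1).
  symmetry; apply Cmult_1_r.
- destruct hf as [c ->].
  apply Rbar_le_lt_trans with (Finite (Cmod c)); [|exact I].
  apply hardy_norm_le_sup; [apply disk_continuous_constant; now exists c|].
  intros z; unfold fn_scal, fn_one; rewrite Cmult_1_r; apply Rle_refl.
Qed.

(** Approximation by constants in Hardy norm controls values at points. If c
    were at distance at least d from f z, then by continuity |f - c| would be at
    least d / 2 on an arc of the circle through z; this forces the integral mean
    over that circle, and so the Hardy norm, above a bound independent of c. *)
Lemma hardy_norm_small_at_point (f : fn) (hf : disk_continuous f) (z : C)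
  (hz : Cmod z < 1) (hz0 : z <> 0) (d : R) (hd : 0 < d) :
  exists eps, 0 < eps /\ forall c : C,
    Rbar_lt (hardy_norm (fn_sub f (fn_scal c fn_one))) eps ->
    Cmod (ext0 f z - c) < d.
Proof.
destruct (circle_point z hz0) as [t [ht ez]].
set (r := Cmod z) in *.
assert (hr : 0 < r < 1) by (split; [now apply Cmod_gt_0|assumption]).
destruct (circle_continuous f hf r t hr (d / 2)) as [e [he H]]; [lra|].
rewrite <- ez in H.
(* an arc around z, clipped to the interval of integration *)
set (u := Rmax 0 (t - e / 2)). set (v := Rmin (2 * PI) (t + e / 2)).
pose proof PI_RGT_0 as hpi.
assert (huv : 0 <= u /\ u < v /\ v <= 2 * PI /\ t - e < u /\ v < t + e).
{ unfold u, v, Rmax, Rmin; destruct Rle_dec; destruct Rle_dec; lra. }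
destruct huv as [hu [huv [hv [hue hve]]]].
(* a lower bound for the squared mean when |f - c| >= d / 2 on the arc *)
set (m := (v - u) * (d / 2) ^ 2 / (2 * PI)).
assert (hm : 0 < m).
{ apply Rdiv_lt_0_compat; [|lra]; apply Rmult_lt_0_compat; [lra|].
  apply pow_lt; lra. }
exists (sqrt m); split; [now apply sqrt_lt_R0|].
intros c hc.
destruct (Rlt_le_dec (Cmod (ext0 f z - c)) d) as [|hfar]; [assumption|exfalso].
apply integral_mean_lt with (r := r) in hc; [|assumption].
unfold integral_mean in hc.
apply sqrt_lt_0_alt in hc.
revert hc; apply Rle_not_lt.
unfold m, Rdiv; apply Rmult_le_compat_r; [left; apply Rinv_0_lt_compat; lra|].
assert (hcont : disk_continuous (fn_sub f (fn_scal c fn_one))).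
{ apply disk_continuous_sub; [assumption|].
  apply disk_continuous_constant; now exists c. }
set (F := fun s => Cmod (ext0 (fn_sub f (fn_scal c fn_one)) (r * cos s, r * sin s)) ^ 2).
assert (hex : forall x y, ex_RInt F x y)
  by (intros x y; now apply ex_RInt_circle).
assert (hpos : forall x y, x <= y -> 0 <= RInt F x y).
{ intros x y hxy; apply RInt_ge_0; [assumption|apply hex|].
  intros s _; apply pow2_ge_0. }
assert (hmid : (v - u) * (d / 2) ^ 2 <= RInt F u v).
{ replace ((v - u) * (d / 2) ^ 2) with (RInt (fun _ => (d / 2) ^ 2) u v)
    by (rewrite RInt_const; reflexivity).
  apply RInt_le; [lra|apply ex_RInt_const|apply hex|].
  intros s hs; apply pow_incr; split; [lra|].
  assert (hs' : Rabs (s - t) < e) by (apply Rabs_def1; lra).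
  specialize (H s hs').
  assert (h : Cmod (r * cos s, r * sin s) < 1) by (rewrite Cmod_circle; lra).
  rewrite (ext0_in f _ h) in H.
  rewrite (ext0_in _ _ h); unfold fn_sub, fn_scal, fn_one.
  set (p := f (exist _ _ h)) in *.
  replace (ext0 f z - c)%C with ((p - c * RtoC 1) + - (p - ext0 f z))%C in hfar by ring.
  pose proof (Cmod_triangle (p - c * RtoC 1) (- (p - ext0 f z))) as htri.
  rewrite Cmod_opp in htri; lra. }
change (RInt _ 0 (2 * PI)) with (RInt F 0 (2 * PI)).
pose proof (RInt_Chasles F 0 u (2 * PI) (hex _ _) (hex _ _)) as h1.
pose proof (RInt_Chasles F u v (2 * PI) (hex _ _) (hex _ _)) as h2.
change (RInt F 0 u + RInt F u (2 * PI) = RInt F 0 (2 * PI)) in h1.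
change (RInt F u v + RInt F v (2 * PI) = RInt F u (2 * PI)) in h2.
pose proof (hpos 0 u hu); pose proof (hpos v (2 * PI) hv); lra.
Qed.

(** One constant close to f in norm is close to f at any two given points at
    once, so any two values of f agree. The pointwise estimate needs a circle of
    positive radius; the origin is recovered by continuity. *)
Lemma limit_of_constants_constant (M : fn -> Prop) (hM : forall f, M f -> constant_fn f)
  (f : fn) : H2_closure M f -> constant_fn f.
Proof.
intros [[hol _] happ].
assert (hf := holomorphic_continuous f hol).
(* a nonzero base point, so that it lies on a circle of positive radius *)
assert (hb : Cmod (RtoC (1 / 2)) < 1) by (rewrite Cmod_R, Rabs_pos_eq; lra).
assert (hb0 : RtoC (1 / 2) <> 0) by (intros e; apply RtoC_inj in e; lra).
assert (key : forall z, Cmod z < 1 -> z <> 0 -> forall d, 0 < d ->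
   Cmod (ext0 f z - ext0 f (RtoC (1 / 2))) < d).
{ intros z hz hz0 d hd.
  destruct (hardy_norm_small_at_point f hf z hz hz0 (d / 2)) as [e1 [he1 H1]]; [lra|].
  destruct (hardy_norm_small_at_point f hf _ hb hb0 (d / 2)) as [e2 [he2 H2]]; [lra|].
  destruct (happ (Rmin e1 e2)) as [p [Mp hp]]; [now apply Rmin_glb_lt|].
  destruct (hM p Mp) as [c ->].
  specialize (H1 c (Rbar_lt_le_trans _ _ (Finite e1) hp (Rmin_l _ _))).
  specialize (H2 c (Rbar_lt_le_trans _ _ (Finite e2) hp (Rmin_r _ _))).
  replace (ext0 f z - ext0 f (RtoC (1 / 2)))%C
    with ((ext0 f z - c) + - (ext0 f (RtoC (1 / 2)) - c))%C by ring.
  eapply Rle_lt_trans; [apply Cmod_triangle|]; rewrite Cmod_opp; lra. }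
exists (ext0 f (RtoC (1 / 2))).
apply functional_extensionality; intros [z hz].
unfold fn_scal, fn_one; rewrite Cmult_1_r, <- (ext0_in f z hz).
apply Ceq_minus, Cmod_eq_0, Rle_antisym; [|apply Cmod_ge_0].
apply Rnot_lt_le; intros hpos.
set (d := Cmod (ext0 f z - ext0 f (RtoC (1 / 2)))) in *.
(* at the origin, compare with a small positive real x *)
destruct (classic (z = 0)) as [z0|z0]; [|exact (Rlt_irrefl _ (key z hz z0 d hpos))].
destruct (hf z hz (d / 2)) as [e [he H]]; [lra|].
set (x := Rmin (1 / 2) (e / 2)).
assert (hx : 0 < x <= 1 / 2 /\ x < e).
{ unfold x, Rmin; destruct Rle_dec; lra. }
assert (hx1 : Cmod (RtoC x) < 1) by (rewrite Cmod_R, Rabs_pos_eq; lra).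
assert (hx0 : RtoC x <> 0) by (intros e'; apply RtoC_inj in e'; lra).
specialize (H (RtoC x) hx1); specialize (key _ hx1 hx0 (d / 2)).
rewrite z0 in H at 1; replace (RtoC x - 0)%C with (RtoC x) in H by ring.
rewrite Cmod_R, Rabs_pos_eq in H by lra.
assert (hlt : d < d).
{ unfold d at 1.
  replace (ext0 f z - ext0 f (RtoC (1 / 2)))%C
    with ((ext0 f (RtoC x) - ext0 f (RtoC (1 / 2))) + - (ext0 f (RtoC x) - ext0 f z))%C
    by ring.
  eapply Rle_lt_trans; [apply Cmod_triangle|]; rewrite Cmod_opp; lra. }
lra.
Qed.

Lemma constants_closed : closed_subspace constant_fn.
Proof.
split; [exact constant_H2|].
split; [exists (RtoC 0); apply functional_extensionality; intros z;
  unfold fn_scal, fn_zero; ring|].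
split.
- intros f g [c ->] [d ->]; exists (c + d)%C; apply functional_extensionality; intros z.
  unfold fn_scal, fn_add; ring.
- split.
  + intros k f [c ->]; exists (k * c)%C; apply functional_extensionality; intros z.
    unfold fn_scal; ring.
  + now apply limit_of_constants_constant.
Qed.

Lemma constants_invariant (a : R) (ha : 0 < a < 1) : invariant a constant_fn.
Proof.
intros f [c ->]; exists c; apply functional_extensionality; intros [z hz].
unfold comp_op; simpl; now rewrite (ext0_in _ _ (phi_disk a ha z hz)).
Qed.

Lemma one_neq_zero : fn_one <> fn_zero.
Proof.
intros e.
assert (h0 : Cmod 0 < 1) by (rewrite Cmod_0; lra).
apply (f_equal (fun f : fn => f (exist _ _ h0))) in e.
unfold fn_one, fn_zero in e; apply RtoC_inj in e; lra.
Qed.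

Lemma constant_one : constant_fn fn_one.
Proof.
exists (RtoC 1); apply functional_extensionality; intros z; unfold fn_scal; ring.
Qed.

Lemma constant_neq_zero (f : fn) : constant_fn f -> f <> fn_zero ->
  exists c, f = fn_scal c fn_one /\ c <> 0.
Proof.
intros [c ->] h; exists c; split; [reflexivity|]; intros ->; apply h.
apply functional_extensionality; intros z; unfold fn_scal, fn_zero; ring.
Qed.

(** The constants form a line, so a nonzero subspace of them is everything. *)
Lemma constants_minimal (a : R) (ha : 0 < a < 1) : minimal_invariant a constant_fn.
Proof.
split; [exact constants_closed|].
split; [now apply constants_invariant|].
split; [exists fn_one; split; [exact constant_one|exact one_neq_zero]|].
intros N [_ [N0 [_ [Nscal _]]]] _ hN.
destruct (classic (exists f, N f /\ f <> fn_zero)) as [[f [Nf hf]]|hno].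
- right; intros h; split; [apply hN|]; intros [d ->].
  destruct (constant_neq_zero f (hN f Nf) hf) as [c [-> hc]].
  replace (fn_scal d fn_one) with (fn_scal (d / c) (fn_scal c fn_one)); [now apply Nscal|].
  apply functional_extensionality; intros z; unfold fn_scal; field; assumption.
- left; intros f; split; [|now intros ->].
  intros Nf; apply NNPP; intros hf; apply hno; now exists f.
Qed.

(** The constants are a nonzero closed invariant subspace of M, so minimality
    leaves no room for anything else. *)
Lemma minimal_of_constants (a : R) (ha : 0 < a < 1) (M : fn -> Prop)
  (hM : forall f, constant_fn f -> M f) :
  minimal_invariant a M -> forall f, M f <-> constant_fn f.
Proof.
intros [_ [_ [_ hmin]]] f.
destruct (hmin _ constants_closed (constants_invariant a ha) hM) as [h|h].
- elim one_neq_zero; apply h, constant_one.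
- now symmetry.
Qed.

Lemma lincomb_1 (c : nat -> C) (e : nat -> fn) : lincomb 1 c e = fn_scal (c 0%nat) (e 0%nat).
Proof.
apply functional_extensionality; intros z; simpl; unfold fn_add, fn_zero; ring.
Qed.

Lemma dim_1_constants : has_dim constant_fn 1.
Proof.
exists (fun _ => fn_one); split; [intros; exact constant_one|split].
- intros c hc i hi; rewrite lincomb_1 in hc.
  replace i with 0%nat by lia.
  apply NNPP; intros hne; apply one_neq_zero.
  replace fn_one with (fn_scal (/ c 0%nat) (fn_scal (c 0%nat) fn_one)).
  + rewrite hc; apply functional_extensionality; intros z; unfold fn_scal, fn_zero; ring.
  + apply functional_extensionality; intros z; unfold fn_scal; field; assumption.
- intros f [c ->]; exists (fun _ => c); now rewrite lincomb_1.
Qed.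

(** The function 1 is a multiple of the basis vector, which is therefore
    constant itself. *)
Lemma dim_1_of_constants (M : fn -> Prop) (hM : forall f, constant_fn f -> M f) :
  has_dim M 1 -> forall f, M f <-> constant_fn f.
Proof.
intros [e [_ [_ hgen]]] f; split; [|apply hM].
intros Mf.
destruct (hgen f Mf) as [c ->]; rewrite lincomb_1.
destruct (hgen fn_one (hM _ constant_one)) as [d hd]; rewrite lincomb_1 in hd.
assert (hd0 : d 0%nat <> 0).
{ intros h; apply one_neq_zero; rewrite hd, h.
  apply functional_extensionality; intros z; unfold fn_scal, fn_zero; ring. }
exists (c 0%nat / d 0%nat)%C; rewrite hd.
apply functional_extensionality; intros z; unfold fn_scal; field; assumption.
Qed.

(** Either property holds exactly when M is the space of constants; this is
    also where the invariance of a one-dimensional M comes from. *)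
Theorem minimal_iff_dim_1 (a : R) (ha : 0 < a < 1) (M : fn -> Prop)
  (hM : forall f, constant_fn f -> M f) : minimal_invariant a M <-> has_dim M 1.
Proof.
split; intros h.
- replace M with constant_fn; [exact dim_1_constants|].
  apply functional_extensionality; intros f; apply propositional_extensionality.
  symmetry; now apply (minimal_of_constants a ha M hM).
- replace M with constant_fn; [now apply constants_minimal|].
  apply functional_extensionality; intros f; apply propositional_extensionality.
  symmetry; now apply dim_1_of_constants.
Qed.

(** * Orbits of the composition operator *)

Lemma pow_range (a : R) (ha : 0 < a < 1) (n : nat) : 0 < a ^ n <= 1.
Proof. split; [apply pow_lt; lra|]; induction n; simpl; [lra|]; nra. Qed.

Lemma phi_pow_disk (a : R) (ha : 0 < a < 1) (n : nat) (z : C) :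
  Cmod z < 1 -> Cmod (phi (a ^ n) z) < 1.
Proof.
intros hz; destruct (pow_range a ha n) as [h0 [h1|h1]]; [now apply phi_disk|].
rewrite h1; replace (phi 1 z) with z; [assumption|unfold phi; ring].
Qed.

(** The affine maps [phi a] contract towards their common fixed point 1, and the
    ratios multiply; so the n-th iterate of [phi a] is [phi (a ^ n)]. *)
Lemma phi_mult (a b : R) (z : C) : phi (a * b) z = phi a (phi b z).
Proof. unfold phi; rewrite RtoC_mult; ring. Qed.

Lemma iter_comp_op (a : R) (ha : 0 < a < 1) (g : fn) (n : nat) (z : disk) :
  Nat.iter n (comp_op a) g z = ext0 g (phi (a ^ n) (proj1_sig z)).
Proof.
revert z; induction n as [|n IH]; intros [z hz].
- simpl; replace (phi 1 z) with z by (unfold phi; ring).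
  symmetry; apply ext0_in.
- change (comp_op a (Nat.iter n (comp_op a) g) (exist _ z hz)
    = ext0 g (phi (a ^ S n) z)).
  unfold comp_op; simpl proj1_sig.
  rewrite (ext0_in _ _ (phi_disk a ha z hz)).
  change (fun x => ext0 ?h (phi a (proj1_sig x))) with (comp_op a h).
  rewrite IH; simpl proj1_sig; rewrite <- phi_mult; f_equal; f_equal; simpl; ring.
Qed.

Lemma span_scal (e : nat -> fn) (k : C) (n : nat) : span e (fn_scal k (e n)).
Proof.
exists (S n), (fun i => if Nat.eq_dec i n then k else RtoC 0).
simpl; destruct (Nat.eq_dec n n) as [_|]; [|contradiction].
assert (H : forall m, (m <= n)%nat ->
  lincomb m (fun i => if Nat.eq_dec i n then k else RtoC 0) e = fn_zero).
{ induction m as [|m IH]; intros hm; [reflexivity|]; simpl.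
  rewrite IH by lia; destruct Nat.eq_dec; [lia|].
  apply functional_extensionality; intros z; unfold fn_add, fn_scal, fn_zero; ring. }
rewrite H by lia.
apply functional_extensionality; intros z; unfold fn_add, fn_scal, fn_zero; ring.
Qed.

(** The n-th iterate of g is g read on the disk D_n, whose radius is a^n and
    whose centre is 1 - a^n. As the disks D_n decrease, |g'| <= B on every D_n
    with n >= N, and g deviates there by at most B * a^n from its central value. *)
Lemma iterates_near_constant (a : R) (ha : 0 < a < 1) (g : fn) (hg : holomorphic g)
  (N : nat) (B : R)
  (hB : forall z : disk, disk_n a N (proj1_sig z) -> Cmod (deriv g z) <= B)
  (n : nat) (hn : (N <= n)%nat) (z : disk) :
  Cmod (Nat.iter n (comp_op a) g z - ext0 g (RtoC (1 - a ^ n))) <= B * a ^ n.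
Proof.
destruct z as [z hz]; rewrite iter_comp_op by assumption; simpl proj1_sig.
destruct (pow_range a ha n) as [hp hp1].
assert (hray : forall t : R, Rabs t <= 1 -> Cmod (RtoC t * z)%C < 1).
{ intros t ht; rewrite Cmod_mult, Cmod_R.
  pose proof (Cmod_ge_0 z); pose proof (Rabs_pos t); nra. }
replace (phi (a ^ n) z) with (RtoC (1 - a ^ n) + RtoC (a ^ n) * z)%C
  by (unfold phi; rewrite RtoC_minus; ring).
assert (hB0 : 0 <= B).
{ eapply Rle_trans; [apply Cmod_ge_0|].
  apply (hB (exist _ _ (phi_pow_disk a ha N z hz))); now exists (exist _ z hz). }
eapply Rle_trans; [apply mean_value_inequality with (B := B); [assumption|]|].
- intros t ht.
  assert (e : (RtoC (1 - a ^ n) + RtoC t * (RtoC (a ^ n) * z))%C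
     = phi (a ^ n) (RtoC t * z)%C) by (unfold phi; rewrite RtoC_minus; ring).
  rewrite e.
  exists (phi_pow_disk a ha n _ (hray t ht)); apply hB; simpl.
  exists (exist (fun u => Cmod u < 1) _ (phi_pow_disk a ha (n - N) _ (hray t ht))); simpl.
  rewrite <- phi_mult, <- pow_add; f_equal; f_equal; lia.
- rewrite Cmod_mult, Cmod_R, Rabs_pos_eq by lra.
  apply Rmult_le_compat_l; [assumption|].
  pose proof (Cmod_ge_0 z); nra.
Qed.

(** Dividing an iterate by g(1 - a^n) keeps the error small along the indices n
    at which this value stays away from 0: the multiple of the n-th iterate by
    c / g(1 - a^n) is within (|c| / m) * B * a^n of c, uniformly on the disk. *)
Lemma constants_in_cyclic_subspace (a : R) (ha : 0 < a < 1) (g : fn) (hg : H2 g)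
  (hEB : eventually_bounded a (deriv g))
  (hsub : has_subseq_away_from_zero (fun n => ext0 g (RtoC (1 - a ^ n))))
  (f : fn) (hf : constant_fn f) : cyclic_subspace a g f.
Proof.
split; [now apply constant_H2|].
destruct hf as [c ->]; intros eps heps.
destruct hg as [hol _].
destruct hEB as [N [B hB]].
destruct hsub as [s [hs [m [hm hsm]]]].
assert (hsk : forall k, (k <= s k)%nat).
{ induction k as [|k IH]; [lia|]; specialize (hs k); lia. }
(* B is only known to bound a modulus; Rabs saves proving it nonnegative *)
set (K := Cmod c / m * Rabs B).
assert (hK : 0 <= K).
{ repeat apply Rmult_le_pos; [apply Cmod_ge_0|left; now apply Rinv_0_lt_compat|apply Rabs_pos]. }
assert (hlim : exists n, (N <= n)%nat /\ m <= Cmod (ext0 g (RtoC (1 - a ^ n)))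
   /\ K * a ^ n < eps).
{ destruct (pow_lt_1_zero a) with (y := eps / (K + 1)) as [P hP].
  - rewrite Rabs_pos_eq; lra.
  - apply Rdiv_lt_0_compat; lra.
  - exists (s (N + P)%nat); specialize (hsk (N + P)%nat); split; [lia|split; [apply hsm|]].
    specialize (hP (s (N + P)%nat) ltac:(lia)).
    destruct (pow_range a ha (s (N + P)%nat)) as [hp _].
    rewrite Rabs_pos_eq in hP by lra.
    apply Rle_lt_trans with ((K + 1) * a ^ s (N + P)%nat); [nra|].
    apply Rlt_le_trans with ((K + 1) * (eps / (K + 1))).
    + apply Rmult_lt_compat_l; lra.
    + right; field; lra. }
destruct hlim as [n [hn [hgn hsmall]]].
set (w := ext0 g (RtoC (1 - a ^ n))) in *.
assert (hw : w <> 0) by (intros e; rewrite e, Cmod_0 in hgn; lra).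
exists (fn_scal (c / w) (Nat.iter n (comp_op a) g)); split.
- apply (span_scal (fun n => Nat.iter n (comp_op a) g)).
- apply Rbar_le_lt_trans with (Finite (K * a ^ n)); [|exact hsmall].
  apply hardy_norm_le_sup.
  + apply disk_continuous_sub; [apply disk_continuous_constant; now exists c|].
    apply disk_continuous_scal.
    apply Nat.iter_invariant; [intros; now apply disk_continuous_comp_op|].
    now apply holomorphic_continuous.
  + intros z; unfold fn_sub, fn_scal, fn_one.
    assert (hnear := iterates_near_constant a ha g hol N B hB n hn z); fold w in hnear.
    set (q := Nat.iter n (comp_op a) g z) in *.
    replace (c * RtoC 1 - c / w * q)%C with (c / w * - (q - w))%C by (field; assumption).
    rewrite Cmod_mult, Cmod_opp, Cmod_div by assumption.
    destruct (pow_range a ha n) as [hp _].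
    unfold K; rewrite Rmult_assoc.
    pose proof (Cmod_ge_0 c) as hc.
    apply Rmult_le_compat; [|apply Cmod_ge_0| |].
    * apply Rmult_le_pos; [assumption|left; apply Rinv_0_lt_compat; lra].
    * apply Rmult_le_compat_l; [assumption|]; apply Rinv_le_contravar; lra.
    * eapply Rle_trans; [exact hnear|].
      apply Rmult_le_compat_r; [lra|apply Rle_abs].
Qed.

Theorem corollary14 (a : R) (ha : 0 < a < 1) (g : fn) (hg : H2 g)
  (hEB : eventually_bounded a (deriv g))
  (hsub : has_subseq_away_from_zero (fun n => ext0 g (RtoC (1 - a ^ n)))) :
  cyclic_subspace a g fn_one /\
  (minimal_invariant a (cyclic_subspace a g) <->
   has_dim (cyclic_subspace a g) 1).
Proof.
assert (hconst := constants_in_cyclic_subspace a ha g hg hEB hsub).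
split; [apply hconst, constant_one|now apply minimal_iff_dim_1].
Qed.
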